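(* Let $A\in\mathbb{R}^{N\times N}$ and $\tilde A\in\mathbb{R}^{n\times n}$ ($n<N$) satisfy, for constants $\omega\geqslant 0$ and $\tilde\omega\geqslant 0$, $$\frac{(\frac12(A+A^T)x,x)}{(x,x)}\geqslant \omega \quad\text{for all } x\in\mathbb{R}^N,\ x\neq 0,\qquad \frac{(\frac12(\tilde A+\tilde A^T)x,x)}{(x,x)}\geqslant \tilde\omega \quad\text{for all } x\in\mathbb{R}^n,\ x\neq 0,$$ and let $\bar\omega=\min\{\omega,\tilde\omega\}$. Let $Q\in\mathbb{R}^{N\times n}$, let $v,g\in\mathbb{R}^N$ be not simultaneously zero, let $\mathtt{tol}>0$, and let $y_{\mathrm{ex}}(t)$ be the exact solution of the initial-value problem $y'(t)=-Ay(t)+g$, $y(0)=v$. Then for the solution $y_{\mathrm{mg}}(t)$ of the two-grid coarse grid correction algorithm (described in the context) it holds, for any $t\geqslant 0$, $$\|y_{\mathrm{ex}}(t)-y_{\mathrm{mg}}(t)\|\leqslant t\left\|\bigl(\varphi(-tA)Q-Q\varphi(-t\tilde A)\bigr)\tilde g\right\| + t\varphi(-t\bar\omega)\,(\|Q\|+1)\,\beta\,\mathtt{tol}$$ $$\leqslant \bigl(t\varphi(-t\bar\omega)\bigr)^2\,\|Q\tilde A-AQ\|\,\|\tilde g\| + t\varphi(-t\bar\omega)\,(\|Q\|+1)\,\beta\,\mathtt{tol},$$ where $\tilde g=Q^T(g-Av)$ and $\beta=\|g-Av\|$.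
   Context: $(\cdot,\cdot)$ is the Euclidean inner product and $\|\cdot\|$ is the Euclidean vector norm or the corresponding operator norm. The function $\varphi$ is the entire function $\varphi(z)=(e^z-1)/z$ for $z\in\mathbb{C}\setminus\{0\}$, $\varphi(0)=1$, and $\varphi(-tA)$ denotes the corresponding matrix function. The exact solution is $y_{\mathrm{ex}}(t)=v+t\varphi(-tA)(g-Av)$. Here $A$ is a fine grid discretization matrix, $\tilde A$ is its coarse grid analogue, and $Q$ and $Q^T$ are the matrices of the (linear) prolongation and restriction operators between the coarse and fine grids. Two-grid coarse grid correction algorithm, for given $A,v,g,t,\mathtt{tol}$: Step 0. Set $\bar g=g-Av$, $\tilde g=Q^T\bar g$, $\hat g=\bar g-QQ^T\bar g$, $\beta=\|\bar g\|$, $\tilde\beta=\|\tilde g\|$, $\hat\beta=\|\hat g\|$. Step 1 (coarse grid). Compute an approximation $\tilde y(s)\approx s\varphi(-s\tilde A)\tilde g$, $s\in[0,t]$, with tolerance $\widetilde{\mathtt{tol}}=(\beta/\tilde\beta)\,\mathtt{tol}$. That is, $\tilde y:[0,t]\to\mathbb{R}^n$ is a continuously differentiable function with $\tilde y(0)=0$ whose residual $\tilde r(s)=-\tilde A\tilde y(s)-\tilde y'(s)+\tilde g$ satisfies $\max_{s\in[0,t]}\|\tilde r(s)\|\leqslant\tilde\beta\,\widetilde{\mathtt{tol}}=\beta\,\mathtt{tol}$. Step 2 (fine grid). Compute an approximation $\hat y(s)\approx s\varphi(-sA)\hat g$, $s\in[0,t]$, with tolerance $\widehat{\mathtt{tol}}=(\beta/\hat\beta)\,\mathtt{tol}$.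 That is, $\hat y:[0,t]\to\mathbb{R}^N$ is a continuously differentiable function with $\hat y(0)=0$ whose residual $\hat r(s)=-A\hat y(s)-\hat y'(s)+\hat g$ satisfies $\max_{s\in[0,t]}\|\hat r(s)\|\leqslant\hat\beta\,\widehat{\mathtt{tol}}=\beta\,\mathtt{tol}$. Step 3. Set $y_{\mathrm{mg}}(t)=v+\hat y(t)+Q\tilde y(t)$. (If $\tilde\beta=0$ or $\hat\beta=0$, the corresponding tolerance requirement is read as the residual bound $\beta\,\mathtt{tol}$.) *)

(* Defs.v *)
From HB Require Import structures.
From mathcomp Require Import all_boot all_order all_algebra.
From mathcomp Require Import all_classical all_reals all_analysis.
Set Implicit Arguments.
Unset Strict Implicit.
Unset Printing Implicit Defensive.
Import Order.TTheory GRing.Theory Num.Theory.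
Import numFieldNormedType.Exports.
Local Open Scope classical_set_scope.
Local Open Scope ring_scope.

Definition dot (R : realType) (n : nat) (x y : 'cV[R]_n) : R :=
  \sum_(i < n) x i 0 * y i 0.

(* The library norm [`|x|] on matrices is the max norm; it is only used below
   through the topology it induces. *)
Definition enorm (R : realType) (n : nat) (x : 'cV[R]_n) : R :=
  Num.sqrt (dot x x).

Definition opnorm (R : realType) (m n : nat) (M : 'M[R]_(m, n)) : R :=
  sup [set enorm (M *m x) | x in [set x : 'cV[R]_n | enorm x <= 1]].

Definition phi (R : realType) (x : R) : R :=
  if x == 0 then 1 else (expR x - 1) / x.

Definition phi_coef (R : realType) (k : nat) : R := (k.+1`!%:R)^-1.

Lemma phi_pseries (R : realType) (x : R) :
  phi x = limn (pseries (@phi_coef R) x).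
Proof.
apply/esym/cvg_lim => //; rewrite /phi; case: eqVneq => [->|x0].
  rewrite -cvg_shiftS /=; apply: cvg_near_cst; apply: nearW => k /=.
  rewrite /pseries /series /= big_nat_recl //= big1 => [|i _].
    by rewrite /phi_coef expr0 mulr1 invr1 addr0.
  by rewrite expr0n mulr0.
have -> : pseries (@phi_coef R) x =
    (fun k => x^-1 * (series (exp_coeff x) k.+1 - 1)).
  apply/funext => k; rewrite /pseries /series /= big_nat_recl //=.
  rewrite {1}/exp_coeff /= expr0 fact0 divr1 addrC addKr mulr_sumr.
  apply: eq_bigr => i _; rewrite /exp_coeff /phi_coef /= exprS.
  by rewrite -mulrA mulKf // mulrC.
rewrite mulrC; apply: cvgMl_tmp; apply: cvgB; last exact: cvg_cst.
rewrite (cvg_shiftS (series (exp_coeff x))).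
exact: is_cvg_series_exp_coeff.
Qed.

(* The matrix function of the entire function [phi], by its power series
   (see [phi_pseries]). *)
Definition phi_mx (R : realType) (n : nat) (M : 'M[R]_n) : 'M[R]_n :=
  limn (series (fun k => phi_coef R k *: M ^+ k)).

(* Derivative at [s] relative to the interval [I], hence one-sided at the
   endpoints of [I]. *)
Definition is_derive_in (R : realType) (n : nat) (I : set R)
    (y : R -> 'cV[R]_n) (s : R) (l : 'cV[R]_n) : Prop :=
  (s' - s)^-1 *: (y s' - y s) @[s' --> within I s^'] --> l.

Definition C1_on (R : realType) (n : nat) (I : set R)
    (y dy : R -> 'cV[R]_n) : Prop :=
  (forall s, I s -> is_derive_in I y s (dy s)) /\ {within I, continuous dy}.

Definition solves_ivp (R : realType) (N : nat) (A : 'M[R]_N)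
    (v g : 'cV[R]_N) (y : R -> 'cV[R]_N) : Prop :=
  y 0 = v /\
  forall s, 0 <= s -> is_derive_in `[0, +oo[ y s (- (A *m y s) + g).

Definition residual (R : realType) (m : nat) (B : 'M[R]_m) (b : 'cV[R]_m)
    (y dy : R -> 'cV[R]_m) (s : R) : 'cV[R]_m :=
  - (B *m y s) - dy s + b.

(* The bound [c * ((beta / c) * tol)] on a residual; for [c = 0] it is read as
   [beta * tol]. *)
Definition residual_bound (R : realType) (beta c tol : R) : R :=
  if c == 0 then beta * tol else c * ((beta / c) * tol).

(* [y s] approximates [s phi(-s B) b] on [0, t]. *)
Definition approx_on (R : realType) (m : nat) (B : 'M[R]_m) (b : 'cV[R]_m)
    (t bound : R) (y : R -> 'cV[R]_m) : Prop :=
  y 0 = 0 /\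
  exists dy : R -> 'cV[R]_m,
    C1_on `[0, t] y dy /\
    forall s, 0 <= s <= t -> enorm (residual B b y dy s) <= bound.

(* [ymg] is a possible result at time [t] of the two-grid algorithm with fine
   matrix [A], coarse matrix [At] and prolongation [Q]. *)
Definition two_grid_result (R : realType) (N n : nat) (A : 'M[R]_N)
    (At : 'M[R]_n) (Q : 'M[R]_(N, n)) (v g : 'cV[R]_N) (t tol : R)
    (ymg : 'cV[R]_N) : Prop :=
  let gbar := g - A *m v in
  let gt := Q^T *m gbar in
  let gh := gbar - Q *m Q^T *m gbar in
  let beta := enorm gbar in
  exists (yt : R -> 'cV[R]_n) (yh : R -> 'cV[R]_N),
    [/\ approx_on At gt t (residual_bound beta (enorm gt) tol) yt,
        approx_on A gh t (residual_bound beta (enorm gh) tol) yh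
      & ymg = v + yh t + Q *m yt t].

(* Main.v *)
(* Put z(s) = s phi(-s At) gt and x(s) = s phi(-s A) Q gt.  The error splits as
   (yex - v - yh - x) + (x - Q z) + Q (z - yt), and each of the three bracketed
   differences d vanishes at 0 and satisfies d' = -A d + r or d' = -At d + r,
   where r is one of the two residuals, or (Q At - A Q) z for the middle one.
   If (B x, x) >= w |x|^2 and |r| <= c, then d' = -B d + r and d(0) = 0 force
   |d(t)| <= t phi(-t w) c; applied to z itself, with r = gt, this also bounds
   the forcing term of the middle difference. *)
Require Import Defs.
From mathcomp Require Import all_boot all_order all_algebra.
From mathcomp Require Import all_classical all_reals all_analysis.
From mathcomp Require Import ring lra.
Import Order.TTheory GRing.Theory Num.Theory.
Import numFieldNormedType.Exports.
Local Open Scope classical_set_scope.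
Local Open Scope ring_scope.

Set Implicit Arguments.
Unset Strict Implicit.
Unset Printing Implicit Defensive.

(** * Euclidean norm, operator norm and coercivity *)

Section EuclideanNorm.
Variable R : realType.

Lemma dotC n (x y : 'cV[R]_n) : dot x y = dot y x.
Proof. by apply: eq_bigr => i _; rewrite mulrC. Qed.

Lemma dotDl n (x y z : 'cV[R]_n) : dot (x + y) z = dot x z + dot y z.
Proof. by rewrite /dot -big_split; apply: eq_bigr => i _; rewrite mxE mulrDl. Qed.

Lemma dotZl n a (x z : 'cV[R]_n) : dot (a *: x) z = a * dot x z.
Proof. by rewrite /dot mulr_sumr; apply: eq_bigr => i _; rewrite mxE mulrA. Qed.

Lemma dotNl n (x z : 'cV[R]_n) : dot (- x) z = - dot x z.
Proof. by rewrite -scaleN1r dotZl mulN1r. Qed.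

Lemma dotDr n (x y z : 'cV[R]_n) : dot z (x + y) = dot z x + dot z y.
Proof. by rewrite !(dotC z) dotDl. Qed.

Lemma dotZr n a (x z : 'cV[R]_n) : dot z (a *: x) = a * dot z x.
Proof. by rewrite !(dotC z) dotZl. Qed.

Lemma dotNr n (x z : 'cV[R]_n) : dot z (- x) = - dot z x.
Proof. by rewrite !(dotC z) dotNl. Qed.

Lemma dot0l n (x : 'cV[R]_n) : dot 0 x = 0.
Proof. by rewrite -(scale0r 0) dotZl mul0r. Qed.

Lemma dot_tr n (M : 'M[R]_n) (x y : 'cV[R]_n) :
  dot (M^T *m x) y = dot (M *m y) x.
Proof.
rewrite /dot (eq_bigr (fun i => \sum_j M j i * x j 0 * y i 0)); last first.
  by move=> i _; rewrite mxE mulr_suml; under eq_bigr do rewrite mxE.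
rewrite exchange_big /=; apply: eq_bigr => i _; rewrite mxE mulr_suml.
by apply: eq_bigr => j _; rewrite mulrAC.
Qed.

Lemma dot_ge0 n (x : 'cV[R]_n) : 0 <= dot x x.
Proof. by apply: sumr_ge0 => i _; rewrite -expr2 sqr_ge0. Qed.

Lemma dot_eq0 n (x : 'cV[R]_n) : (dot x x == 0) = (x == 0).
Proof.
apply/eqP/eqP => [x0|->]; last by rewrite dot0l.
apply/colP => i; rewrite mxE; apply/eqP; rewrite -sqrf_eq0 expr2; apply/eqP.
by apply: (psumr_eq0P _ x0) => // j _; rewrite -expr2 sqr_ge0.
Qed.

Lemma enorm_ge0 n (x : 'cV[R]_n) : 0 <= enorm x.
Proof. exact: sqrtr_ge0. Qed.

Lemma sqr_enorm n (x : 'cV[R]_n) : enorm x ^+ 2 = dot x x.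
Proof. by rewrite sqr_sqrtr // dot_ge0. Qed.

Lemma enorm0 n : enorm (0 : 'cV[R]_n) = 0.
Proof. by rewrite /enorm dot0l sqrtr0. Qed.

Lemma enorm_eq0 n (x : 'cV[R]_n) : (enorm x == 0) = (x == 0).
Proof. by rewrite -dot_eq0 -sqr_enorm sqrf_eq0. Qed.

Lemma enormZ n a (x : 'cV[R]_n) : enorm (a *: x) = `|a| * enorm x.
Proof. by rewrite /enorm dotZl dotZr mulrA -expr2 sqrtrM ?sqr_ge0// sqrtr_sqr. Qed.

Lemma enormN n (x : 'cV[R]_n) : enorm (- x) = enorm x.
Proof. by rewrite -scaleN1r enormZ normrN1 mul1r. Qed.

(** Cauchy-Schwarz: the squared norm of |y| x - |x| y is 2 |x| |y| (|x| |y| - (x, y)), and the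
    factor |x| |y| cancels when both vectors are nonzero. *)
Lemma dot_le_enorm n (x y : 'cV[R]_n) : dot x y <= enorm x * enorm y.
Proof.
have [->|x0] := eqVneq x 0; first by rewrite dot0l mulr_ge0 ?enorm_ge0.
have [->|y0] := eqVneq y 0; first by rewrite dotC dot0l mulr_ge0 ?enorm_ge0.
have x1 : 0 < enorm x by rewrite lt_def enorm_eq0 x0 enorm_ge0.
have y1 : 0 < enorm y by rewrite lt_def enorm_eq0 y0 enorm_ge0.
have := dot_ge0 (enorm y *: x - enorm x *: y).
rewrite -scaleNr !(dotDl, dotDr, dotZl, dotZr) -!sqr_enorm (dotC y x) => h.
have h2 : 0 <= enorm x * enorm y * (enorm x * enorm y - dot x y) by nra.
by move: h2; rewrite pmulr_rge0 ?mulr_gt0 // subr_ge0.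
Qed.

Lemma ler_enormD n (x y : 'cV[R]_n) : enorm (x + y) <= enorm x + enorm y.
Proof.
rewrite -(@ler_pXn2r _ 2) ?nnegrE ?addr_ge0 ?enorm_ge0 //.
rewrite sqr_enorm sqrrD !sqr_enorm dotDl !dotDr (dotC y x).
by have := dot_le_enorm x y; lra.
Qed.

(** The Frobenius norm is an upper bound, by Cauchy-Schwarz on each row. Boundedness is what makes
    the supremum in [opnorm] dominate its set. *)
Lemma opnorm_ubound m n (M : 'M[R]_(m, n)) :
  has_ubound [set enorm (M *m x) | x in [set x : 'cV[R]_n | enorm x <= 1]].
Proof.
exists (Num.sqrt (\sum_i dot (row i M)^T (row i M)^T)) => _ [x /= x1 <-].
rewrite ler_sqrt ?sumr_ge0 // => [|i _]; last exact: dot_ge0.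
apply: ler_sum => i _; rewrite -expr2.
have -> : (M *m x) i 0 = dot (row i M)^T x.
  by rewrite mxE; apply: eq_bigr => j _; rewrite !mxE.
rewrite -sqr_enorm -ler_sqrt ?sqr_ge0 // !sqrtr_sqr (ger0_norm (enorm_ge0 _)).
have cs y : dot (row i M)^T y <= enorm (row i M)^T * enorm y.
  exact: dot_le_enorm.
have e0 := enorm_ge0 (row i M)^T.
rewrite ler_norml; apply/andP; split.
  by rewrite lerNl -dotNr; apply: le_trans (cs _) _; rewrite enormN; nra.
by apply: le_trans (cs _) _; nra.
Qed.

Lemma opnorm_ge0 m n (M : 'M[R]_(m, n)) : 0 <= opnorm M.
Proof.
apply: ub_le_sup; first exact: opnorm_ubound.
by exists 0; rewrite /= ?enorm0 ?mulmx0 ?enorm0.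
Qed.

Lemma enorm_mulmx_le m n (M : 'M[R]_(m, n)) (x : 'cV[R]_n) :
  enorm (M *m x) <= opnorm M * enorm x.
Proof.
have [->|x0] := eqVneq x 0; first by rewrite mulmx0 !enorm0 mulr0.
have x1 : 0 < enorm x by rewrite lt_def enorm_eq0 x0 enorm_ge0.
rewrite -ler_pdivrMr // mulrC -(gtr0_norm (_ : 0 < (enorm x)^-1)) ?invr_gt0 //.
rewrite -enormZ scalemxAr; apply: ub_le_sup; first exact: opnorm_ubound.
exists ((enorm x)^-1 *: x) => //=.
by rewrite enormZ gtr0_norm ?invr_gt0 // mulVf ?gt_eqF.
Qed.

Lemma dot_sym_part n (M : 'M[R]_n) (x : 'cV[R]_n) :
  dot ((2%:R^-1 *: (M + M^T)) *m x) x = dot (M *m x) x.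
Proof. by rewrite -scalemxAl mulmxDl dotZl dotDl dot_tr; field. Qed.

(** The skew part of [M] contributes nothing to (M x, x), and clearing the denominator extends the
    Rayleigh bound to x = 0. *)
Lemma dot_coercive n (M : 'M[R]_n) w :
  (forall x : 'cV[R]_n, x != 0 ->
     dot ((2%:R^-1 *: (M + M^T)) *m x) x / dot x x >= w) ->
  forall x : 'cV[R]_n, w * dot x x <= dot (M *m x) x.
Proof.
move=> Mw x; have [->|x0] := eqVneq x 0; first by rewrite mulmx0 !dot0l mulr0.
rewrite -ler_pdivlMr ?lt_def ?dot_eq0 ?x0 ?dot_ge0 //.
by rewrite -dot_sym_part Mw.
Qed.

End EuclideanNorm.

(** * Coordinatewise differentiation on an interval *)

Section CoordinatewiseDerivative.
Variable R : realType.

Lemma cvg_sum_ord T (F : set_system T) (FF : Filter F) n (f : 'I_n -> T -> R)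
    (l : 'I_n -> R) :
  (forall i, f i x @[x --> F] --> l i) ->
  \sum_(i < n) f i x @[x --> F] --> \sum_(i < n) l i.
Proof.
elim: n f l => [|n IH] f l fl.
  under eq_fun do rewrite big_ord0.
  by rewrite big_ord0; exact: cvg_cst.
under eq_fun do rewrite big_ord_recr.
by rewrite big_ord_recr; apply: cvgD => //; exact: IH.
Qed.

Lemma is_derive_sum_fun n (h : 'I_n -> R -> R) (x : R) (dh : 'I_n -> R) :
  (forall i, is_derive x 1 (h i) (dh i)) ->
  is_derive x 1 (fun s => \sum_(i < n) h i s) (\sum_(i < n) dh i).
Proof.
move=> hd; have -> : (fun s => \sum_(i < n) h i s) = \sum_(i < n) h i.
  by apply/funext => s; rewrite fct_sumE.
exact: is_derive_sum.
Qed.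

(** Tailored to the monotonicity theorem for real functions, which asks for continuity on the closed
    interval and for derivatives only inside it. *)
Definition deriv_on m (t : R) (y dy : R -> 'cV[R]_m) : Prop :=
  (forall i, {within `[0, t], continuous (fun s => y s i 0)}) /\
  (forall s, s \in `]0, t[ ->
     forall i, is_derive s 1 (fun x => y x i 0) (dy s i 0)).

Lemma deriv_onB m t (y z dy dz : R -> 'cV[R]_m) :
  deriv_on t y dy -> deriv_on t z dz ->
  deriv_on t (fun s => y s - z s) (fun s => dy s - dz s).
Proof.
move=> [cy dy'] [cz dz'].
have E i : (fun s => (y s - z s) i 0) = (fun s => y s i 0 - z s i 0).
  by apply/funext => s; rewrite !mxE.
split => [i s|s st i]; rewrite E.
  by apply: cvgB; [exact: cy|exact: cz].
by rewrite !mxE; apply: is_deriveB; [exact: dy'|exact: dz'].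
Qed.

Lemma deriv_on_mulmx m p (M : 'M[R]_(p, m)) t (y dy : R -> 'cV[R]_m) :
  deriv_on t y dy -> deriv_on t (fun s => M *m y s) (fun s => M *m dy s).
Proof.
move=> [cy dy'].
have E i : (fun s => (M *m y s) i 0) = (fun s => \sum_j M i j * y s j 0).
  by apply/funext => s; rewrite mxE.
split => [i s|s st i]; rewrite E.
  by apply: cvg_sum_ord => j; apply: cvgMl_tmp; exact: cy.
by rewrite mxE; apply: is_derive_sum_fun => j; apply: is_deriveZ; exact: dy'.
Qed.

Lemma deriv_on_subr_cst m (v : 'cV[R]_m) t (y dy : R -> 'cV[R]_m) :
  deriv_on t y dy -> deriv_on t (fun s => y s - v) dy.
Proof.
move=> ydy; have -> : dy = fun s => dy s - 0 by apply/funext => s; rewrite subr0.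
apply: deriv_onB => //; split => [i s|s _ i]; first exact: cvg_cst.
by rewrite mxE; exact: is_derive_cst.
Qed.

End CoordinatewiseDerivative.

(** * The scalar function s phi(s w) and the norm estimate *)

Section Comparison.
Variable R : realType.

(** The function is (expR (x w) - 1) / w, or x when w = 0: the integral of expR (u w) over
    [0, x]. *)
Lemma is_derive_mul_phi (w s : R) :
  is_derive s 1 (fun x => x * phi (x * w)) (expR (s * w)).
Proof.
have [->|w0] := eqVneq w 0.
  under eq_fun do rewrite mulr0 /phi eqxx mulr1.
  by rewrite mulr0 expR0; exact: is_derive_id.
have -> : (fun x => x * phi (x * w)) = (fun x => w^-1 * (expR (x * w) - 1)).
  apply/funext => x; rewrite /phi mulf_eq0 (negbTE w0) orbF.
  have [->|x0] := eqVneq x 0; first by rewrite !mul0r expR0 subrr mulr0.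
  by field; rewrite w0 x0.
by apply: is_derive_eq; rewrite /GRing.scale /=; field.
Qed.

(** With a = t w this is 1 - e^(-a) = e^(-a) (e^a - 1). It turns the growing bound given by an
    integrating factor into the decaying one of the theorem. *)
Lemma mul_phiN (w t : R) :
  t * phi (- t * w) = expR (- (t * w)) * (t * phi (t * w)).
Proof.
have [tw|tw] := eqVneq (t * w) 0.
  by rewrite mulNr tw oppr0 expR0 mul1r.
rewrite /phi mulNr oppr_eq0 (negbTE tw).
have := expRxMexpNx_1 (t * w); set a := expR _; set b := expR _ => ab.
have [t0 w0] : t != 0 /\ w != 0 by apply/andP; rewrite -negb_or -mulf_eq0.
have -> : b * (t * ((a - 1) / (t * w))) = t * ((a * b - b) / (t * w)).
  by field; apply/andP.
by rewrite ab; field; apply/andP.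
Qed.

(** The derivative is an exponential, hence positive for either sign of [w]; [phi_commutator_le]
    uses it with the sign reversed. *)
Lemma mul_phi_le (w s t : R) : s <= t -> s * phi (s * w) <= t * phi (t * w).
Proof.
move=> st; pose f x := x * phi (x * w).
have D (x : R) : is_derive x 1 f (expR (x * w)) by exact: is_derive_mul_phi.
have df (x : R) : derivable f x 1 by have [] := D x.
have dfge0 (x : R) : 0 <= f^`()%classic x.
  by rewrite derive1E; have [_ ->] := D x; exact: expR_ge0.
have cf : {within `[s, t], continuous f}.
  by apply: derivable_within_continuous.
apply: (ger0_derive1_le_cc _ _ cf) => //; by rewrite in_itv /= lexx ?andbT.
Qed.

Lemma mul_phi_ge0 (w t : R) : 0 <= t -> 0 <= t * phi (t * w).
Proof. by move/(mul_phi_le w); rewrite mul0r. Qed.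

End Comparison.

(* With f = sqrt (|d|^2 + e^2), which is differentiable even where d = 0, the
   function expR (s w) f(s) - (c + w e) s phi(s w) is nonincreasing; then e
   tends to 0. *)
Lemma enorm_deriv_on_le (R : realType) m (B : 'M[R]_m) (w c t : R)
    (d dd : R -> 'cV[R]_m) :
  0 <= w -> 0 <= c -> 0 <= t ->
  (forall x : 'cV[R]_m, w * dot x x <= dot (B *m x) x) ->
  d 0 = 0 -> deriv_on t d dd ->
  (forall s, s \in `]0, t[ -> enorm (dd s + B *m d s) <= c) ->
  enorm (d t) <= t * phi (- t * w) * c.
Proof.
move=> w0 c0 t0 Bw d0 [cd Dd] rc.
have main e : 0 < e ->
    expR (t * w) * enorm (d t) <= e + (c + w * e) * (t * phi (t * w)).
  move=> e0.
  pose f s := Num.sqrt (\sum_i d s i 0 * d s i 0 + e ^+ 2).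
  pose p s := s * phi (s * w).
  pose g s := expR (s * w) * f s - (c + w * e) * p s.
  have rad0 s : 0 < \sum_i d s i 0 * d s i 0 + e ^+ 2.
    by rewrite ltr_wpDl ?exprn_gt0 //; exact: dot_ge0.
  have f0 s : 0 < f s by rewrite sqrtr_gt0.
  have f2 s : f s ^+ 2 = enorm (d s) ^+ 2 + e ^+ 2.
    by rewrite sqr_sqrtr ?(ltW (rad0 s)) // sqr_enorm.
  have fe s : e <= f s.
    rewrite -(@ler_pXn2r _ 2) ?nnegrE ?(ltW e0) ?(ltW (f0 s)) // f2.
    by rewrite lerDr sqr_ge0.
  have fd s : enorm (d s) <= f s.
    rewrite -(@ler_pXn2r _ 2) ?nnegrE ?(ltW (f0 s)) ?enorm_ge0 // f2.
    by rewrite lerDl sqr_ge0.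
  have Dg s : s \in `]0, t[ -> is_derive s 1 g
      (expR (s * w) * (w * f s + dot (dd s) (d s) / f s - (c + w * e))).
    move=> st.
    have Dp : is_derive s 1 p (expR (s * w)) by exact: is_derive_mul_phi.
    have Df : is_derive s 1 f ((f s)^-1 * dot (dd s) (d s)).
      have DN : is_derive s 1 (fun s => \sum_i d s i 0 * d s i 0 + e ^+ 2)
          (dot (dd s) (d s) *+ 2).
        have DS : is_derive s 1 (fun s => \sum_i d s i 0 * d s i 0)
            (\sum_i (d s i 0 * dd s i 0 + d s i 0 * dd s i 0)).
          by apply: is_derive_sum_fun => i; have Di := Dd s st i; exact: is_deriveM.
        apply: is_derive_eq; rewrite addr0 /dot -sumrMnl; apply: eq_bigr => i _.
        by rewrite mulr2n mulrC.
      have DQ := @is_derive1_sqrt R _ (rad0 s).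
      have := @is_derive1_comp R Num.sqrt _ s _ _ DQ DN.
      congr is_derive; rewrite -/(f s).
      by have fs : f s != 0 := lt0r_neq0 (f0 s); field.
    apply: is_derive_eq; rewrite /GRing.scale /=.
    by have fs : f s != 0 := lt0r_neq0 (f0 s); field.
  have cg : {within `[0, t], continuous g}.
    have cp : continuous p.
      by move=> x; apply/differentiable_continuous/derivable1_diffP;
        have [] := is_derive_mul_phi w x.
    have ce : continuous (fun s : R => expR (s * w)).
      move=> x; apply: continuous_comp; first exact: mulrr_continuous.
      exact: continuous_expR.
    move=> s; apply: cvgB.
      apply: cvgM; first exact: (continuous_subspaceT ce).
      apply: (@continuous_cvg _ _ _ _ _ _ Num.sqrt); first exact: sqrt_continuous.
      apply: cvgD; last exact: cvg_cst.
      by apply: cvg_sum_ord => i; apply: cvgM; exact: cd.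
    by apply: cvgMl_tmp; exact: (continuous_subspaceT cp).
  have g_le : g t <= g 0.
    apply: (ler0_derive1_le_cc _ _ cg) => //.
    - by move=> x xt; have [] := Dg x xt.
    - move=> s st; rewrite derive1E; have [_ ->] := Dg s st.
      rewrite pmulr_rle0 ?expR_gt0 // subr_le0.
      have fs := f0 s; rewrite -(ler_pM2r fs) mulrDl divfK ?gt_eqF //.
      (* The derivative is split into the defect dd + B d, handled by Cauchy-Schwarz, and - B d,
         handled by coercivity. *)
      have -> : dot (dd s) (d s) =
          dot (dd s + B *m d s) (d s) - dot (B *m d s) (d s).
        by rewrite -dotNl -dotDl addrK.
      have h1 := dot_le_enorm (dd s + B *m d s) (d s).
      have h2 := rc s st; have h3 := Bw (d s); rewrite -sqr_enorm in h3.
      have h4 := enorm_ge0 (d s); have h5 := fd s; have h6 := fe s; have h7 := f2 s.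
      have h8 : enorm (dd s + B *m d s) * enorm (d s) <= c * f s by nra.
      (* Coercivity yields |d|^2 instead of f^2. Since f^2 = |d|^2 + e^2 and e <= f, the loss is at
         most w e f, which the extra w e in [g] absorbs. *)
      have h9 : w * f s * f s <= w * enorm (d s) ^+ 2 + w * e * f s.
        have -> : w * f s * f s = w * f s ^+ 2 by ring.
        by rewrite h7 mulrDr lerD2l expr2 -mulrA ler_wpM2l // ler_wpM2l // ltW.
      by lra.
    - by rewrite in_itv /= lexx ?t0.
    - by rewrite in_itv /= lexx ?t0.
  move: g_le; rewrite /g /p mul0r expR0 mul1r mul0r mulr0 subr0.
  have -> : f 0 = e.
    rewrite /f d0 big1 => [|i _]; last by rewrite mxE mulr0.
    by rewrite add0r sqrtr_sqr gtr0_norm.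
  rewrite lerBlDr; apply: le_trans.
  by rewrite ler_wpM2l ?expR_ge0.
have lim : expR (t * w) * enorm (d t) <= c * (t * phi (t * w)).
  apply/ler_addgt0Pr => e e0; set P := t * phi (t * w).
  have P0 : 0 <= P by exact: mul_phi_ge0.
  have k0 : 0 < 1 + w * P by rewrite ltr_wpDr // mulr_ge0.
  (* With parameter e', [main] exceeds c P by e' (1 + w P); this choice of e' makes the excess
     exactly e. *)
  have := main (e / (1 + w * P)) (divr_gt0 e0 k0); rewrite -/P => h.
  apply: le_trans h _; rewrite le_eqVlt; apply/orP; left; apply/eqP.
  by field; rewrite gt_eqF.
rewrite mul_phiN -(ler_pM2l (expR_gt0 (t * w))).
suff -> : expR (t * w) * (expR (- (t * w)) * (t * phi (t * w)) * c) =
  c * (t * phi (t * w)) by [].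
by rewrite -[RHS]mul1r -(expRxMexpNx_1 (t * w)); ring.
Qed.

(** * Power series of s phi(s M) and its differential equation *)

Section MatrixPhi.
Variable R : realType.

(** The coefficients are dominated by those of C e^(L x), so the series is compared with the
    exponential series at L |x|. *)
Lemma is_cvg_pseries_exp_bound (c : R^nat) (C L x : R) :
  0 <= L -> (forall k, `|c k| <= C * (L ^+ k / k`!%:R)) -> cvgn (pseries c x).
Proof.
move=> L0 cL; apply: normed_cvg.
pose v := fun k => C * exp_coeff (L * `|x|) k.
have uv k : `|c k * x ^+ k| <= v k.
  rewrite normrM normrX /v /exp_coeff /= exprMn mulrAC mulrA.
  by rewrite ler_wpM2r ?exprn_ge0.
apply: (series_le_cvg _ _ uv) => [k|k|]; first exact: normr_ge0.
  exact: le_trans (normr_ge0 _) (uv k).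
rewrite (_ : v = C *: exp_coeff (L * `|x|)) //; apply: is_cvg_seriesZ.
exact: is_cvg_series_exp_coeff.
Qed.

(** Exponential domination survives formal differentiation, as C e^(L x) has derivative C L e^(L x);
    so it can be iterated. *)
Lemma pseries_diffs_exp_bound (c : R^nat) (C L : R) :
  (forall k, `|c k| <= C * (L ^+ k / k`!%:R)) ->
  forall k, `|pseries_diffs c k| <= C * L * (L ^+ k / k`!%:R).
Proof.
move=> cL k; rewrite /pseries_diffs normrM normr_nat.
apply: (le_trans (ler_wpM2l (ler0n _ _) (cL k.+1))).
rewrite factS natrM exprS le_eqVlt; apply/orP; left; apply/eqP; field.
by rewrite nat1r !pnatr_eq0 -lt0n fact_gt0.
Qed.

Lemma is_derive_pseries (c : R^nat) (C L x : R) :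
  0 <= L -> (forall k, `|c k| <= C * (L ^+ k / k`!%:R)) ->
  is_derive x (1 : R) (fun x => limn (pseries c x))
    (limn (pseries (pseries_diffs c) x)).
Proof.
(* Termwise differentiation at x asks that the series and its first two formal derivatives converge
   at a point of larger modulus. *)
move=> L0 cL; apply: (@pseries_snd_diffs _ c (`|x| + 1)).
- exact: is_cvg_pseries_exp_bound cL.
- exact: is_cvg_pseries_exp_bound (pseries_diffs_exp_bound cL).
- exact: is_cvg_pseries_exp_bound
    (pseries_diffs_exp_bound (pseries_diffs_exp_bound cL)).
- by rewrite [ltRHS]ger0_norm ?ltrDl // addr_ge0.
Qed.

(** Matrix balls are entrywise, and a filter is closed under finite intersections. *)
Lemma mx_cvg m n T (F : set_system T) (FF : Filter F) (f : T -> 'M[R]_(m, n))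
    (l : 'M[R]_(m, n)) :
  (forall i j, f x i j @[x --> F] --> l i j) -> f @ F --> l.
Proof.
move=> fl; apply/cvg_ballP => e e0; near=> x; split => //.
move=> i j; move: j; move: i; near: x.
apply: filter_forall => i; apply: filter_forall => j.
exact: (@cvg_ball _ _ _ F FF _ _ (fl i j) e e0).
Unshelve. all: by end_near. Qed.

Variables (n : nat) (M : 'M[R]_n).

(** By induction, a row sum being at most the sum over all entries. The summand 1 makes the base at
    least 1, so that [mul_phi_coef_le] may raise the exponent by one. *)
Lemma expmx_coord_le i j k :
  `|(M ^+ k) i j| <= (1 + \sum_i \sum_j `|M i j|) ^+ k.
Proof.
set K := \sum_i _; have K0 : 0 <= K by do 2 (apply: sumr_ge0 => ? _).
elim: k i j => [|k IH] i j.
  by rewrite !expr0 mxE; case: eqP; rewrite ?normr1 ?normr0.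
rewrite exprS mxE (le_trans (ler_norm_sum _ _ _)) //.
apply: (@le_trans _ _ (\sum_l `|M i l| * (1 + K) ^+ k)).
  by apply: ler_sum => l _; rewrite normrM ler_wpM2l.
rewrite -mulr_suml exprS ler_wpM2r ?exprn_ge0 ?addr_ge0 //.
apply: (@le_trans _ _ K); last by rewrite lerDr.
by rewrite /K [leRHS](bigD1 i) //= lerDl; do 2 (apply: sumr_ge0 => ? _).
Qed.

(* Coefficients of the power series of [s phi(s M)] at the entry [(i, j)]. *)
Definition mul_phi_coef i j k : R :=
  if k is k'.+1 then phi_coef R k' * (M ^+ k') i j else 0.

Lemma mul_phi_coef_le i j k :
  `|mul_phi_coef i j k| <= 1 * ((1 + \sum_i \sum_j `|M i j|) ^+ k / k`!%:R).
Proof.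
set K := \sum_i _; have K0 : 0 <= K by do 2 (apply: sumr_ge0 => ? _).
rewrite mul1r; case: k => [|k] /=.
  by rewrite normr0 divr_ge0 ?exprn_ge0 ?addr_ge0.
rewrite normrM /phi_coef normfV normr_nat mulrC ler_wpM2r ?invr_ge0 //.
apply: (le_trans (expmx_coord_le i j k)).
by rewrite exprS ler_peMl ?exprn_ge0 ?addr_ge0 // lerDl.
Qed.

Lemma sum_abs_ge0 : 0 <= 1 + \sum_i \sum_j `|M i j|.
Proof. by rewrite addr_ge0 //; do 2 (apply: sumr_ge0 => ? _). Qed.

Lemma is_cvg_mul_phi i j s : cvgn (pseries (mul_phi_coef i j) s).
Proof. exact: is_cvg_pseries_exp_bound sum_abs_ge0 (mul_phi_coef_le i j). Qed.

Lemma exprZmx s k : (s *: M) ^+ k = s ^+ k *: M ^+ k.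
Proof.
elim: k => [|k IH]; first by rewrite !expr0 scale1r.
by rewrite !exprS IH -!mulmxE -scalemxAl -scalemxAr scalerA.
Qed.

(** The entry map is continuous, so it commutes with the limit defining [phi_mx]; the factor s then
    shifts the scalar series by one index. *)
Lemma phi_mx_coordE s i j :
  s * phi_mx (s *: M) i j = limn (pseries (mul_phi_coef i j) s).
Proof.
pose c i j k := phi_coef R k * (M ^+ k) i j.
have cc i' j' : cvgn (pseries (c i' j') s).
  apply: (is_cvg_pseries_exp_bound (C := 1) sum_abs_ge0) => k.
  rewrite mul1r /c normrM mulrC ler_pM ?expmx_coord_le //.
  rewrite /phi_coef normfV normr_nat lef_pV2 ?posrE ?ltr0n ?fact_gt0 //.
  by rewrite ler_nat leq_fact.
pose u := series (fun k => phi_coef R k *: (s *: M) ^+ k).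
have uE k i' j' : u k i' j' = pseries (c i' j') s k.
  rewrite /u /pseries /series /= summxE; apply: eq_bigr => l _.
  by rewrite exprZmx !mxE /c; ring.
(* Convergence of every entry makes the matrix series converge, so that its [limn] is a genuine
   limit. *)
have cu : u @ \oo --> (\matrix_(i, j) limn (pseries (c i j) s) : 'M[R]_n).
  by apply: mx_cvg => i' j'; rewrite mxE; under eq_fun do rewrite uE; exact: cc.
have -> : phi_mx (s *: M) i j = limn (pseries (c i j) s).
  apply/esym/cvg_lim => //.
  have : u k i j @[k --> \oo] --> (limn u) i j.
    apply: (@continuous_cvg _ _ _ _ _ u (fun A : 'M[R]_n => A i j)).
      exact: coord_continuous.
    exact: cvgP cu.
  by under eq_fun do rewrite uE.
apply/esym/cvg_lim => //; rewrite -cvg_shiftS.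
have -> : (fun k => pseries (mul_phi_coef i j) s k.+1) =
    (fun k => s * pseries (c i j) s k).
  apply/funext => k; rewrite /pseries /series /= big_nat_recl //= mul0r add0r.
  by rewrite mulr_sumr; apply: eq_bigr => l _; rewrite exprS /c; ring.
by apply: cvgMl_tmp; exact: cc.
Qed.

(** The coefficient of s^k in the formal derivative is M^k / k!: the identity for k = 0, and M times
    the coefficient of s^k in s phi(s M) for k > 0. *)
Lemma is_derive_mul_phi_mx (s : R) i j :
  is_derive s 1 (fun x : R => x * phi_mx (x *: M) i j)
    ((1%:M + M *m (s *: phi_mx (s *: M))) i j).
Proof.
under eq_fun do rewrite phi_mx_coordE.
have := is_derive_pseries s sum_abs_ge0 (mul_phi_coef_le i j).
congr is_derive; apply/cvg_lim => //.
(* The equation holds already between partial sums, except that the empty sum lacks the identity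
   term; hence the case k = 0, which a shift removes in the limit. *)
have -> : pseries (pseries_diffs (mul_phi_coef i j)) s =
    (fun k => (if k == 0%N then 0 else 1%:M i j) +
      \sum_l M i l * pseries (mul_phi_coef l j) s k).
  apply/funext; elim => [|k IH].
    rewrite /pseries /series /= big_nil add0r big1 // => l _.
    by rewrite big_nil mulr0.
  rewrite /pseries /series /= big_nat_recr //=.
  move: IH; rewrite /pseries /series /= => ->.
  under [in RHS]eq_bigr do rewrite big_nat_recr //= mulrDr.
  rewrite big_split /=.
  have -> : pseries_diffs (mul_phi_coef i j) k * s ^+ k =
      (if k == 0%N then 1%:M i j else 0) +
      \sum_l M i l * (mul_phi_coef l j k * s ^+ k).
    rewrite /pseries_diffs /= /phi_coef; case: k => [|k] /=.
      rewrite big1 => [|l _]; last by rewrite mul0r mulr0.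
      by rewrite !expr0 invr1 addr0 !mulr1 !mul1r.
    rewrite add0r exprS -mulmxE mxE mulr_sumr mulr_sumr mulr_suml.
    apply: eq_bigr => l _; rewrite /phi_coef factS natrM; field.
    by rewrite -natrD !pnatr_eq0 -lt0n fact_gt0.
  by case: (k == 0%N); ring.
have -> : (1%:M + M *m (s *: phi_mx (s *: M))) i j =
    1%:M i j + \sum_l M i l * (s * phi_mx (s *: M) l j).
  by rewrite mxE; congr (_ + _); rewrite mxE; under eq_bigr do rewrite mxE.
apply: cvgD; first by rewrite -cvg_shiftS /=; exact: cvg_cst.
apply: cvg_sum_ord => l; apply: cvgMl_tmp.
by rewrite phi_mx_coordE; exact: is_cvg_mul_phi.
Qed.

(** With M the negative of a grid matrix, this is the equation of the reference functions x and z in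
    the error splitting. *)
Lemma deriv_on_phi (b : 'cV[R]_n) (t : R) :
  deriv_on t (fun s => s *: (phi_mx (s *: M) *m b))
    (fun s => M *m (s *: (phi_mx (s *: M) *m b)) + b).
Proof.
have D (s : R) i : is_derive s 1 (fun s : R => (s *: (phi_mx (s *: M) *m b)) i 0)
    ((M *m (s *: (phi_mx (s *: M) *m b)) + b) i 0).
  have -> : (fun s => (s *: (phi_mx (s *: M) *m b)) i 0) =
      (fun s => \sum_j s * phi_mx (s *: M) i j * b j 0).
    apply/funext => x; rewrite !mxE mulr_sumr.
    by apply: eq_bigr => j _; rewrite mulrA.
  have -> : M *m (s *: (phi_mx (s *: M) *m b)) + b =
      (1%:M + M *m (s *: phi_mx (s *: M))) *m b.
    by rewrite mulmxDl mul1mx addrC -mulmxA scalemxAl.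
  rewrite mxE; apply: is_derive_sum_fun => j.
  have Dj := is_derive_mul_phi_mx s i j.
  have := @is_deriveM R R _ (cst (b j 0)) s 1 _ _ Dj (is_derive_cst _ _ _).
  by congr is_derive; rewrite /GRing.scale /= mulr0 add0r mulrC.
split => [i|s _ i]; last exact: D.
by apply: derivable_within_continuous => x _; have [] := D x i.
Qed.

End MatrixPhi.

(** * From derivatives relative to an interval to coordinatewise ones *)

Section DerivativeWithin.
Variable R : realType.

Lemma within_dnbhs (I : set R) (s : R) :
  nbhs s I -> within I s^' = s^'.
Proof.
move=> Is; apply/seteqP; split => P PI; last by apply: filterS PI => x + _.
have Is' : s^' I by exact: nbhs_dnbhs.
by apply: (@filterS2 _ s^' _ _ _ P _ Is' PI) => x ? ; apply.
Qed.

Lemma is_derive_in_coord m (I : set R) (y : R -> 'cV[R]_m) s l i :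
  is_derive_in I y s l ->
  (s' - s)^-1 * (y s' i 0 - y s i 0) @[s' --> within I s^'] --> l i 0.
Proof.
move=> yl; have -> : (fun s' => (s' - s)^-1 * (y s' i 0 - y s i 0)) =
    (fun A : 'cV[R]_m => A i 0) \o (fun s' => (s' - s)^-1 *: (y s' - y s)).
  by apply/funext => s'; rewrite /= !mxE.
by apply: continuous_cvg yl; exact: coord_continuous.
Qed.

Lemma is_derive_in_is_derive m (I : set R) (y : R -> 'cV[R]_m) s l i :
  nbhs s I -> is_derive_in I y s l ->
  is_derive s 1 (fun x => y x i 0) (l i 0).
Proof.
move=> Is /(is_derive_in_coord (i := i)); rewrite within_dnbhs // => yli.
(* Change of variable s' = s + h, from a limit in the point to a limit in the increment. *)
have H : h^-1 *: (((fun x => y x i 0) \o shift s) (h *: 1) - y s i 0)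
    @[h --> 0^'] --> l i 0.
  apply/cvgrPdist_lt => e e0.
  have /cvgrPdist_lt/(_ e e0) := yli.
  move=> /nbhs_ballP[d d0 sd]; apply/nbhs_ballP; exists d => // h hd h0 /=.
  have := sd (h + s); rewrite /= addrK [h *: 1]mulr1; apply.
    by move: hd; rewrite /ball /= sub0r normrN opprD addrCA subrr addr0 normrN.
  by rewrite -subr_eq0 addrK.
by apply: DeriveDef; [apply: cvgP H|apply: cvg_lim H].
Qed.

(** Away from s, y(x) is y(s) plus (x - s) times the difference quotient, and that product tends to
    0. The argument also covers endpoints of [I]. *)
Lemma is_derive_in_cvg m (I : set R) (y : R -> 'cV[R]_m) s l i :
  is_derive_in I y s l -> y x i 0 @[x --> within I (nbhs s)] --> y s i 0.
Proof.
move=> /(is_derive_in_coord (i := i)) yli.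
have yc : (x - s) * ((x - s)^-1 * (y x i 0 - y s i 0)) + y s i 0
    @[x --> within I s^'] --> y s i 0.
  rewrite -[X in _ --> X]add0r -[X in _ --> X + _](mul0r (l i 0)).
  apply: cvgD; last exact: cvg_cst.
  apply: cvgM => //; rewrite -(subrr s); apply: cvgB; last exact: cvg_cst.
  by apply: cvg_within_filter; apply: cvg_within_filter; exact: cvg_id.
apply/cvgrPdist_lt => e e0; have /cvgrPdist_lt/(_ e e0) := yc.
move=> h; near=> x; have [->|xs] := eqVneq x s.
  by rewrite subrr normr0.
have Ix : I x by near: x; exact: withinT.
have : x != s -> I x ->
    `|y s i 0 - ((x - s) * ((x - s)^-1 * (y x i 0 - y s i 0)) + y s i 0)| < e.
  by near: x; apply: cvg_within; exact: h.
move=> /(_ xs Ix); rewrite mulrA divff ?subr_eq0 // mul1r.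
by rewrite subrK.
Unshelve. all: by end_near. Qed.

(** [I] is [0, t] for the computed approximations and the half-line for the exact solution. *)
Lemma deriv_on_derive_in m (I : set R) t (y dy : R -> 'cV[R]_m) :
  `[0, t] `<=` I -> (forall s, I s -> is_derive_in I y s (dy s)) ->
  deriv_on t y dy.
Proof.
move=> tI yI; split => [i|s st i].
  apply: continuous_subspaceW tI _; apply/subspace_continuousP => s Is.
  exact: is_derive_in_cvg (yI s Is).
have st' : `]0, t[%classic s by [].
apply: (is_derive_in_is_derive (I := I)); last first.
  by apply: yI; apply: tI; apply: subset_itv_oo_cc.
apply: filterS (subset_trans _ tI) _; first exact: subset_itv_oo_cc.
by apply: open_nbhs_nbhs; split => //; exact: itv_open.
Qed.

End DerivativeWithin.

(** * Bounds on a single grid *)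

Section PhiError.
Variables (R : realType) (m : nat) (B : 'M[R]_m) (w : R).
Hypotheses (w0 : 0 <= w) (Bw : forall x : 'cV[R]_m, w * dot x x <= dot (B *m x) x).

Lemma residual_boundE (beta c tol : R) : residual_bound beta c tol = beta * tol.
Proof.
by rewrite /residual_bound; case: eqVneq => // c0; field.
Qed.

Lemma approx_on_deriv (b : 'cV[R]_m) t c y : approx_on B b t c y ->
  exists dy, deriv_on t y dy /\
    forall s, s \in `]0, t[ -> enorm (dy s + B *m y s - b) <= c.
Proof.
move=> [_ [dy [[ydy _] rc]]]; exists dy; split.
  exact: (deriv_on_derive_in (I := `[0, t]%classic)).
move=> s; rewrite in_itv /= => /andP[s0 st].
apply: le_trans (rc s _); last by rewrite !ltW.
rewrite -enormN /residual le_eqVlt; apply/orP; left; apply/eqP; congr enorm.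
by rewrite !opprD opprK addrC [- dy s - _]addrC addrC.
Qed.

(** Here z' + B z is the constant b, so the norm estimate applies with c = |b|. *)
Lemma enorm_mul_phi_mx_le (b : 'cV[R]_m) t : 0 <= t ->
  enorm (t *: (phi_mx (t *: - B) *m b)) <= t * phi (- t * w) * enorm b.
Proof.
move=> t0; pose z s := s *: (phi_mx (s *: - B) *m b).
apply: (enorm_deriv_on_le (d := z) w0 (enorm_ge0 b) t0 Bw _
  (deriv_on_phi _ _ _)); first by rewrite /z scale0r.
by move=> s _; rewrite mulNmx addrAC addNr add0r.
Qed.

(** The difference d = z - y vanishes at 0, and d' + B d is exactly the residual of y. *)
Lemma approx_on_error (b : 'cV[R]_m) t c y : 0 <= t -> 0 <= c ->
  approx_on B b t c y ->
  enorm (t *: (phi_mx (t *: - B) *m b) - y t) <= t * phi (- t * w) * c.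
Proof.
move=> t0 c0 yc; have [dy [ydy rc]] := approx_on_deriv yc.
pose z s := s *: (phi_mx (s *: - B) *m b).
apply: (enorm_deriv_on_le (d := fun s => z s - y s) w0 c0 t0 Bw _
  (deriv_onB (deriv_on_phi _ _ _) ydy)).
  by rewrite /z scale0r; have [-> _] := yc; rewrite subr0.
move=> s st; rewrite -enormN; apply: le_trans (rc s st).
rewrite le_eqVlt; apply/orP; left; apply/eqP; congr enorm.
rewrite -/(z s) mulmxBr mulNmx.
by apply/colP => i; rewrite !mxE; ring.
Qed.

End PhiError.

(** * Transfer between the grids and the final bounds *)

Section TwoGrid.
Variables (R : realType) (N n : nat) (A : 'M[R]_N) (At : 'M[R]_n).
Variables (Q : 'M[R]_(N, n)) (w t : R).
Hypotheses (w0 : 0 <= w) (t0 : 0 <= t).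
Hypothesis Aw : forall x : 'cV[R]_N, w * dot x x <= dot (A *m x) x.
Hypothesis Atw : forall x : 'cV[R]_n, w * dot x x <= dot (At *m x) x.

(** In d = x - Q z the source Q b cancels, leaving d' + A d = (Q At - A Q) z. One factor t phi(-t w)
    bounds z, the other comes from the estimate for d. *)
Lemma phi_commutator_le (b : 'cV[R]_n) :
  enorm (t *: (phi_mx (t *: - A) *m (Q *m b))
         - Q *m (t *: (phi_mx (t *: - At) *m b)))
  <= t * phi (- t * w) *
     (opnorm (Q *m At - A *m Q) * (t * phi (- t * w) * enorm b)).
Proof.
pose x s := s *: (phi_mx (s *: - A) *m (Q *m b)).
pose z s := s *: (phi_mx (s *: - At) *m b).
have C0 := opnorm_ge0 (Q *m At - A *m Q).
have p0 : 0 <= t * phi (- t * w) by rewrite mulNr -mulrN; exact: mul_phi_ge0.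
apply: (enorm_deriv_on_le (d := fun s => x s - Q *m z s) w0 _ t0 Aw _
  (deriv_onB (deriv_on_phi _ _ _) (deriv_on_mulmx _ (deriv_on_phi _ _ _)))).
- exact: mulr_ge0 C0 (mulr_ge0 p0 (enorm_ge0 b)).
- by rewrite /x /z !scale0r mulmx0 subr0.
move=> s; rewrite in_itv /= => /andP[s0 st].
have -> : - A *m x s + Q *m b - Q *m (- At *m z s + b) + A *m (x s - Q *m z s) =
    (Q *m At - A *m Q) *m z s.
  rewrite mulmxBl mulmxDr mulmxBr !mulNmx mulmxN !mulmxA.
  by apply/colP => i; rewrite !mxE; ring.
apply: le_trans (enorm_mulmx_le _ _) _; rewrite ler_wpM2l //.
(* The bound on z(s) depends on s; monotonicity replaces it by its value at t. *)
apply: le_trans (enorm_mul_phi_mx_le w0 Atw b (ltW s0)) _.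
rewrite ler_wpM2r ?enorm_ge0 //.
by rewrite mulNr -mulrN mulNr -mulrN mul_phi_le // ltW.
Qed.

(** Superposition: yex - v starts at 0 with source g - A v, of which x carries b and yh the rest.
    What remains as forcing is the residual of yh. *)
Lemma exact_fine_error (v g b : 'cV[R]_N) (yex yh : R -> 'cV[R]_N) (c : R) :
  0 <= c -> solves_ivp A v g yex -> approx_on A (g - A *m v - b) t c yh ->
  enorm (yex t - v - yh t - t *: (phi_mx (t *: - A) *m b))
  <= t * phi (- t * w) * c.
Proof.
move=> c0 [yex0 Dyex] yhc; have [dyh [Dyh rc]] := approx_on_deriv yhc.
pose x s := s *: (phi_mx (s *: - A) *m b).
have Dy : deriv_on t yex (fun s => - (A *m yex s) + g).
  apply: (deriv_on_derive_in (I := `[0, +oo[%classic)).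
    by apply: subset_itvl; rewrite bnd_simp.
  by move=> s /=; rewrite in_itv /= andbT => /Dyex.
apply: (enorm_deriv_on_le (d := fun s => yex s - v - yh s - x s) w0 c0 t0 Aw _
  (deriv_onB (deriv_onB (deriv_on_subr_cst v Dy) Dyh) (deriv_on_phi _ _ _))).
  by have [yh0 _] := yhc; rewrite yex0 yh0 /x scale0r !subr0 subrr.
move=> s st; rewrite -enormN; apply: le_trans (rc s st).
rewrite le_eqVlt; apply/orP; left; apply/eqP; congr enorm.
rewrite -/(x s) !mulmxBr mulNmx.
by apply/colP => i; rewrite !mxE; ring.
Qed.

End TwoGrid.

Theorem proposition3p1 (R : realType) (N n : nat) (A : 'M[R]_N)
    (At : 'M[R]_n) (omega omegat : R) (Q : 'M[R]_(N, n)) (v g : 'cV[R]_N)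
    (tol : R) (yex : R -> 'cV[R]_N) :
  (n < N)%N ->
  0 <= omega -> 0 <= omegat ->
  (forall x : 'cV[R]_N, x != 0 ->
     dot ((2%:R^-1 *: (A + A^T)) *m x) x / dot x x >= omega) ->
  (forall x : 'cV[R]_n, x != 0 ->
     dot ((2%:R^-1 *: (At + At^T)) *m x) x / dot x x >= omegat) ->
  ~ (v = 0 /\ g = 0) ->
  0 < tol ->
  solves_ivp A v g yex ->
  forall (t : R) (ymg : 'cV[R]_N),
    0 <= t ->
    two_grid_result A At Q v g t tol ymg ->
    let omegab := Num.min omega omegat in
    let gt := Q^T *m (g - A *m v) in
    let beta := enorm (g - A *m v) in
    let tphi := t * phi (- t * omegab) in
    enorm (yex t - ymg)
      <= t * enorm ((phi_mx (- t *: A) *m Q - Q *m phi_mx (- t *: At)) *m gt)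
         + tphi * (opnorm Q + 1) * beta * tol
    /\
    t * enorm ((phi_mx (- t *: A) *m Q - Q *m phi_mx (- t *: At)) *m gt)
         + tphi * (opnorm Q + 1) * beta * tol
      <= tphi ^+ 2 * opnorm (Q *m At - A *m Q) * enorm gt
         + tphi * (opnorm Q + 1) * beta * tol.

Proof.
move=> _ omega0 omegat0 Aco Atco _ tol0 yexA t ymg t0 [yt [yh [ytc yhc ->]]].
move=> wb gt beta tphi.
have wb0 : 0 <= wb by rewrite le_min omega0.
(* The minimum is a coercivity constant for both matrices, so one factor t phi(-t wb) serves all
   differences. *)
have Aw x : wb * dot x x <= dot (A *m x) x.
  by apply: le_trans (dot_coercive Aco x); rewrite ler_wpM2r ?dot_ge0 ?ge_min ?lexx.
have Atw x : wb * dot x x <= dot (At *m x) x.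
  apply: le_trans (dot_coercive Atco x).
  by rewrite ler_wpM2r ?dot_ge0 ?ge_min ?lexx ?orbT.
have bt0 : 0 <= beta * tol by rewrite mulr_ge0 ?enorm_ge0 ?ltW.
rewrite !residual_boundE -/beta -/gt in ytc yhc.
(* Reassociation gives the fine source the form g - A v - b with b = Q gt, as [exact_fine_error]
   expects. *)
rewrite -mulmxA -/gt in yhc.
pose x := t *: (phi_mx (t *: - A) *m (Q *m gt)).
pose z := t *: (phi_mx (t *: - At) *m gt).
have xzE : t * enorm ((phi_mx (- t *: A) *m Q - Q *m phi_mx (- t *: At)) *m gt) =
    enorm (x - Q *m z).
  rewrite -[X in X * _]ger0_norm // -enormZ /x /z !scalerN -!scaleNr.
  by rewrite mulmxBl scalerBr -!mulmxA -scalemxAr.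
rewrite xzE; split; last first.
  rewrite lerD2r; apply: le_trans (phi_commutator_le Q wb0 t0 Aw Atw gt) _.
  by rewrite -/tphi le_eqVlt; apply/orP; left; apply/eqP; ring.
have -> : yex t - (v + yh t + Q *m yt t) =
    (x - Q *m z) + ((yex t - v - yh t - x) + Q *m (z - yt t)).
  by rewrite mulmxBr; apply/colP => i; rewrite !mxE; ring.
apply: le_trans (ler_enormD _ _) _; rewrite lerD2l.
apply: le_trans (ler_enormD _ _) _.
(* The fine grid error contributes the 1 and the prolonged coarse grid error the |Q| in the factor
   |Q| + 1. *)
have e1 := exact_fine_error wb0 t0 Aw bt0 yexA yhc.
have e2 := approx_on_error wb0 Atw t0 bt0 ytc.
have e3 := le_trans (enorm_mulmx_le Q _) (ler_wpM2l (opnorm_ge0 Q) e2).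
apply: le_trans (lerD e1 e3) _; rewrite -/tphi.
by rewrite le_eqVlt; apply/orP; left; apply/eqP; ring.
Qed.
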